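(* $\mathcal{F}(x)$ and $\mathcal{G}(x)$ are algebraically independent over $\mathbb{C}(x)$.
   Context: A word is a finite sequence; $[\cdot,\cdot]$ denotes concatenation, $-\boldsymbol{w}$ is the word with all entries negated, $\overleftarrow{\boldsymbol{w}}$ is the reversed word. Let $\boldsymbol{w}_0=\boldsymbol{w}_1$ be the empty word and, for $n\ge2$, $\boldsymbol{w}_n=[\boldsymbol{w}_{n-2},\,(-1)^n,\,-\overleftarrow{\boldsymbol{w}_{n-2}},\,(-1)^n,\,\boldsymbol{w}_{n-1}]$, a word with entries $\pm1$. For a finite sequence $a=(a_0,\dots,a_N)$ let $\operatorname{GF}(a)=\sum_{m=0}^Na_mx^m$ (and $0$ for the empty word). Since $\boldsymbol{w}_{n-2}$ is a prefix of $\boldsymbol{w}_n$, the coefficientwise limits $\mathcal{F}(x)=\lim_{n\to\infty}\operatorname{GF}(\boldsymbol{w}_{2n})$ and $\mathcal{G}(x)=\lim_{n\to\infty}\operatorname{GF}(\boldsymbol{w}_{2n+1})$ exist as power series in $\mathbb{C}[[x]]$. *)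

(* Defs.v *)
From HB Require Import structures.
From mathcomp Require Import all_boot all_order all_algebra.
From mathcomp Require Import fraction generic_quotient.
From mathcomp Require Import boolp classical_sets reals.
From mathcomp Require Import complex.
(* The notations of mpoly clash with those of classical_sets. *)
From mathcomp Require Import -(notations) mpoly.

Set Implicit Arguments.
Unset Strict Implicit.
Unset Printing Implicit Defensive.

Import GRing.Theory.
Local Open Scope ring_scope.

(* Formal power series K[[x]]; [coefs f m] is the coefficient of x^m.  A record
   (rather than a bare function type) keeps the Cauchy product apart from the
   pointwise ring structure that functions already carry. *)
Record fps (K : Type) := FPS { coefs : nat -> K }.

HB.instance Definition _ (K : Type) := gen_eqMixin (fps K).
HB.instance Definition _ (K : Type) := gen_choiceMixin (fps K).

Lemma fpsP (K : Type) (f g : fps K) : coefs f =1 coefs g -> f = g.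
Proof. by case: f g => [f] [g] /= /funext ->. Qed.

Section FpsRing.
Variable K : comNzRingType.
Implicit Types f g h : fps K.

Definition fps_zero : fps K := FPS (fun _ => 0).
Definition fps_one : fps K := FPS (fun m => (m == 0%N)%:R).
Definition fps_opp f : fps K := FPS (fun m => - coefs f m).
Definition fps_add f g : fps K := FPS (fun m => coefs f m + coefs g m).
Definition fps_mul f g : fps K :=
  FPS (fun m => \sum_(i < m.+1) coefs f i * coefs g (m - i)).

Fact fps_addA : associative fps_add.
Proof. by move=> f g h; apply: fpsP => m /=; rewrite addrA. Qed.
Fact fps_addC : commutative fps_add.
Proof. by move=> f g; apply: fpsP => m /=; rewrite addrC. Qed.
Fact fps_add0 : left_id fps_zero fps_add.
Proof. by move=> f; apply: fpsP => m /=; rewrite add0r. Qed.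
Fact fps_addN : left_inverse fps_zero fps_opp fps_add.
Proof. by move=> f; apply: fpsP => m /=; rewrite addNr. Qed.

HB.instance Definition _ :=
  GRing.isZmodule.Build (fps K) fps_addA fps_addC fps_add0 fps_addN.

Definition fps_trunc n f : {poly K} := \poly_(i < n.+1) coefs f i.

Lemma coef_fps_trunc n f m : (m <= n)%N -> (fps_trunc n f)`_m = coefs f m.
Proof. by move=> le_mn; rewrite coef_poly ltnS le_mn. Qed.

Lemma coef_fps_mul_trunc n f g m : (m <= n)%N ->
  coefs (fps_mul f g) m = (fps_trunc n f * fps_trunc n g)`_m.
Proof.
move=> le_mn; rewrite coefM /=; apply: eq_bigr => i _.
have le_im : (i <= m)%N by rewrite -ltnS.
by rewrite !coef_fps_trunc ?(leq_trans le_im) // (leq_trans (leq_subr _ _)).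
Qed.

Fact fps_mulA : associative fps_mul.
Proof.
move=> f g h; apply: fpsP => m.
transitivity ((fps_trunc m f * (fps_trunc m g * fps_trunc m h))`_m).
  rewrite coefM /=; apply: eq_bigr => i _.
  rewrite -(coef_fps_mul_trunc _ _ (leq_subr i m)).
  by rewrite coef_fps_trunc // -ltnS.
rewrite mulrA coefM /=; apply: eq_bigr => i _.
rewrite -(@coef_fps_mul_trunc m f g i) -1?ltnS //.
by rewrite coef_fps_trunc ?leq_subr.
Qed.

Fact fps_mulC : commutative fps_mul.
Proof.
by move=> f g; apply: fpsP => m; rewrite !(@coef_fps_mul_trunc m) // mulrC.
Qed.

Fact fps_mul1 : left_id fps_one fps_mul.
Proof.
move=> f; apply: fpsP => m /=; rewrite big_ord_recl /= mul1r subn0.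
by rewrite big1 ?addr0 // => i _; rewrite mul0r.
Qed.

Fact fps_mulDl : left_distributive fps_mul fps_add.
Proof.
move=> f g h; apply: fpsP => m /=; rewrite -big_split /=.
by apply: eq_bigr => i _; rewrite mulrDl.
Qed.

Fact fps_one_neq0 : fps_one != 0 :> fps K.
Proof. by apply/eqP => /(congr1 (@coefs K)) /(congr1 (@^~ 0%N)) /= /eqP; rewrite oner_eq0. Qed.

HB.instance Definition _ := GRing.Zmodule_isComNzRing.Build (fps K)
  fps_mulA fps_mulC fps_mul1 fps_mulDl fps_one_neq0.

(* The units are the invertible series; inversion is obtained by choice. *)
Definition fps_unit : pred (fps K) := fun f => `[< exists g, g * f = 1 >].
Definition fps_inv f : fps K :=
  if pselect (exists g, g * f = 1) is left e then projT1 (cid e) else f.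

Fact fps_mulVf : {in fps_unit, left_inverse 1 fps_inv *%R}.
Proof.
move=> f /asboolP uf; rewrite /fps_inv; case: pselect => // e.
exact: projT2 (cid e).
Qed.
Fact fps_unitP f g : g * f = 1 -> fps_unit f.
Proof. by move=> gf1; apply/asboolP; exists g. Qed.
Fact fps_inv_out : {in [predC fps_unit], fps_inv =1 id}.
Proof.
by move=> f /asboolP uf; rewrite /fps_inv; case: pselect.
Qed.

HB.instance Definition _ := GRing.ComNzRing_hasMulInverse.Build (fps K)
  fps_mulVf fps_unitP fps_inv_out.

Definition fps_of_poly (p : {poly K}) : fps K := FPS (fun m => p`_m).

Fact fps_of_poly_zmod_morphism : zmod_morphism fps_of_poly.
Proof. by move=> p q; apply: fpsP => m /=; rewrite coefB. Qed.
Fact fps_of_poly_monoid_morphism : monoid_morphism fps_of_poly.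
Proof.
split; first by apply: fpsP => m /=; rewrite coef1.
by move=> p q; apply: fpsP => m /=; rewrite coefM.
Qed.
HB.instance Definition _ := GRing.isZmodMorphism.Build {poly K} (fps K)
  fps_of_poly fps_of_poly_zmod_morphism.
HB.instance Definition _ := GRing.isMonoidMorphism.Build {poly K} (fps K)
  fps_of_poly fps_of_poly_monoid_morphism.

Lemma fps_of_poly_inj : injective fps_of_poly.
Proof. by move=> p q [] pq; apply/polyP => m; move/(congr1 (@^~ m)): pq. Qed.

End FpsRing.

Section FpsDomain.
Variable K : idomainType.

Lemma fps_neq0P (f : fps K) : f != 0 ->
  exists m, coefs f m != 0 /\ forall i, (i < m)%N -> coefs f i = 0.
Proof.
move=> nz_f; have ex_m : exists m, coefs f m != 0.
  apply: contrapT => no_m; move/eqP: nz_f; apply; apply: fpsP => m /=.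
  by apply/eqP/negPn/negP => nz_m; apply: no_m; exists m.
case: (ex_minnP ex_m) => m nz_m min_m; exists m; split=> // i lt_im.
by apply/eqP; apply: contraTT lt_im => /min_m; rewrite -leqNgt.
Qed.

Fact fps_mulf_eq0 (f g : fps K) : f * g = 0 -> (f == 0) || (g == 0).
Proof.
move=> fg0; apply/negPn/negP; rewrite negb_or => /andP[].
move=> /fps_neq0P[m [nz_m fm]] /fps_neq0P[n [nz_n gn]].
have: coefs (f * g) (m + n) = 0 by rewrite fg0.
have lt_m : (m < (m + n).+1)%N by rewrite ltnS leq_addr.
rewrite /= (bigD1 (Ordinal lt_m)) //= addKn big1 ?addr0.
  by apply/eqP; rewrite mulf_neq0.
move=> i; rewrite -val_eqE /= neq_ltn => /orP[/fm ->|lt_mi].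
  by rewrite mul0r.
have le_i : (i <= m + n)%N by rewrite -ltnS.
by rewrite gn ?mulr0 // -(ltn_add2r i) subnK // [ltnRHS]addnC ltn_add2r.
Qed.

HB.instance Definition _ :=
  GRing.ComUnitRing_isIntegral.Build (fps K) fps_mulf_eq0.

End FpsDomain.

(* An injective morphism of integral domains extends to fraction fields. *)
Section FracMap.
Variables (R S : idomainType) (f : {rmorphism R -> S}).
Hypothesis f_inj : injective f.

(* The injectivity argument is unused in the body; it lets the morphism
   instances below be inferred from the term. *)
Definition frac_map of injective f := fun x : {fraction R} =>
  FracField.tofrac (f \n_(repr x)) / FracField.tofrac (f \d_(repr x))
  : {fraction S}.

Local Notation tofrac := (@FracField.tofrac _).
Local Notation phi := (frac_map f_inj).

Let fN0 a : a != 0 -> tofrac (f a) != 0 :> {fraction S}.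
Proof. by rewrite tofrac_eq0; apply: contra => /eqP; rewrite -(rmorph0 f) => /f_inj ->. Qed.

Let fracE (x : {fraction R}) :
  x = tofrac \n_(repr x) / tofrac \d_(repr x).
Proof.
set r := repr x; have dN0 : tofrac \d_r != 0 :> {fraction R}.
  by rewrite tofrac_eq0 denom_ratioP.
apply: (mulIf dN0); rewrite divfK // -[x]reprK -/r.
unlock FracField.tofrac; rewrite -[LHS]FracField.pi_mul.
apply/eqmodP; rewrite /= FracField.equivfE /FracField.mulf.
by rewrite !numden_Ratio ?mulf_neq0 ?oner_neq0 ?denom_ratioP // !mulr1 mulrC.
Qed.

Lemma frac_mapE a b : b != 0 ->
  phi (tofrac a / tofrac b) = tofrac (f a) / tofrac (f b).
Proof.
move=> bN0; set x := _ / _; rewrite /frac_map; set r := repr x.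
have dN0 : \d_r != 0 by exact: denom_ratioP.
apply/eqP; rewrite eqr_div ?fN0 // -!tofracM tofrac_eq -!rmorphM; apply/eqP.
congr (f _); apply/eqP; rewrite -tofrac_eq !tofracM; apply/eqP.
have := fracE x; rewrite -/r {1}/x => /eqP.
by rewrite eqr_div ?tofrac_eq0 // => /eqP ->.
Qed.

Fact frac_map_zmod_morphism : zmod_morphism phi.
Proof.
move=> x y; rewrite (fracE x) (fracE y).
move: (repr x) (repr y) => r s.
have [rN0 sN0] := (denom_ratioP r, denom_ratioP s).
rewrite !frac_mapE // -!mulNr !addf_div ?fN0 ?tofrac_eq0 //.
rewrite -!tofracN -!tofracM -!tofracD frac_mapE ?mulf_neq0 //.
by rewrite rmorphD !rmorphM rmorphN.
Qed.

Fact frac_map_monoid_morphism : monoid_morphism phi.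
Proof.
split.
  have -> : 1 = tofrac 1 / tofrac 1 :> {fraction R} by rewrite tofrac1 divr1.
  by rewrite frac_mapE ?oner_neq0 // rmorph1 tofrac1 divr1.
move=> x y; rewrite (fracE x) (fracE y).
move: (repr x) (repr y) => r s.
have [rN0 sN0] := (denom_ratioP r, denom_ratioP s).
rewrite !frac_mapE // !mulf_div -!tofracM frac_mapE ?mulf_neq0 //.
by rewrite !rmorphM.
Qed.

HB.instance Definition _ := GRing.isZmodMorphism.Build
  {fraction R} {fraction S} phi frac_map_zmod_morphism.
HB.instance Definition _ := GRing.isMonoidMorphism.Build
  {fraction R} {fraction S} phi frac_map_monoid_morphism.

End FracMap.

(* The fields K(x) and K((x)) = Frac K[[x]], and the inclusion of the former in
   the latter. *)
Notation ratfun K := {fraction {poly K}}.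
Notation laurent K := {fraction (fps K)}.
Definition laurent_of_ratfun (K : fieldType) :
    {rmorphism ratfun K -> laurent K} :=
  frac_map (@fps_of_poly_inj K).
Definition laurent_of_fps (K : fieldType) (f : fps K) : laurent K :=
  FracField.tofrac f.

(* The family v of elements of L is algebraically independent over K, seen in L
   through iota: no nonzero polynomial over K vanishes at v. *)
Definition alg_independent (K L : fieldType) (iota : {rmorphism K -> L})
    (n : nat) (v : 'I_n -> L) : Prop :=
  forall P : mpoly n K, mmap iota v P = 0 -> P = 0.

(* Coefficientwise limits: each coefficient is eventually constant. *)
Definition fps_cvg (K : Type) (u : nat -> fps K) (f : fps K) : Prop :=
  forall m, exists N, forall n, (N <= n)%N -> coefs (u n) m = coefs f m.

(* The default value 0 plays no role below: see calF_cvg and calG_cvg. *)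
Definition fps_lim (K : comNzRingType) (u : nat -> fps K) : fps K :=
  xget 0 [set f | fps_cvg u f].

Lemma fps_cvg_unique (K : Type) (u : nat -> fps K) (f g : fps K) :
  fps_cvg u f -> fps_cvg u g -> f = g.
Proof.
move=> uf ug; apply: fpsP => m; have [[M fM] [N gN]] := (uf m, ug m).
by rewrite -(fM (maxn M N)) ?leq_maxl // gN ?leq_maxr.
Qed.

Lemma fps_cvg_lim (K : comNzRingType) (u : nat -> fps K) (f : fps K) :
  fps_cvg u f -> fps_lim u = f.
Proof.
move=> uf; apply: (@fps_cvg_unique _ u) => //.
exact: (@xgetPex _ 0 [set f | fps_cvg u f]) (ex_intro _ f uf).
Qed.

Fixpoint word (n : nat) : seq int :=
  match n with
  | 0 | 1 => [::]
  | (k.+1 as n1).+1 =>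
      word k ++ [:: (-1) ^+ n] ++ map -%R (rev (word k)) ++ [:: (-1) ^+ n] ++ word n1
  end.

Definition GF (K : nzRingType) (a : seq int) : {poly K} :=
  Poly [seq c%:~R | c <- a].

Definition calF (K : comNzRingType) : fps K :=
  fps_lim (fun n => fps_of_poly (GF K (word (2 * n)))).
Definition calG (K : comNzRingType) : fps K :=
  fps_lim (fun n => fps_of_poly (GF K (word (2 * n + 1)))).

Section LimitsExist.

Lemma wE n : word n.+2 =
  word n ++ [:: (-1) ^+ n.+2] ++ map -%R (rev (word n)) ++ [:: (-1) ^+ n.+2] ++ word n.+1.
Proof. by []. Qed.

Lemma prefix_w m k : prefix (word m) (word (m + 2 * k)).
Proof.
elim: k => [|k IHk]; first by rewrite muln0 addn0 prefix_refl.
by rewrite mulnS addnCA add2n wE (prefix_trans IHk) ?prefix_prefix.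
Qed.

Lemma size_w m k : (k <= size (word (m + 2 * k)))%N.
Proof.
elim: k => // k IHk; rewrite mulnS addnCA add2n wE !size_cat /= addnCA add1n ltnS.
by rewrite (leq_trans IHk) ?leq_addr.
Qed.

Lemma GF_cvg (K : comNzRingType) m :
  exists f, fps_cvg (fun n => fps_of_poly (GF K (word (m + 2 * n)))) f.
Proof.
exists (FPS (fun i => (GF K (word (m + 2 * i.+1)))`_i)) => i; exists i.+1 => n le_in /=.
rewrite /GF !coef_Poly.
have /prefixP[s] := prefix_w (m + 2 * i.+1) (n - i.+1).
rewrite -addnA -mulnDr subnKC // => ->.
by rewrite map_cat nth_cat size_map size_w.
Qed.

Lemma calF_cvg (K : comNzRingType) :
  fps_cvg (fun n => fps_of_poly (GF K (word (2 * n)))) (calF K).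
Proof. by have [f uf] := GF_cvg K 0; rewrite /calF (fps_cvg_lim uf). Qed.

Lemma calG_cvg (K : comNzRingType) :
  fps_cvg (fun n => fps_of_poly (GF K (word (2 * n + 1)))) (calG K).
Proof.
have [f] := GF_cvg K 1; under [X in fps_cvg X]funext => n do rewrite addnC.
by move=> uf; rewrite /calG (fps_cvg_lim uf).
Qed.

End LimitsExist.

(* Main.v *)
Require Import Defs.
From HB Require Import structures.
From mathcomp Require Import all_boot all_order all_algebra.
From mathcomp Require Import reals complex fraction mpoly.
From mathcomp Require Import ring zify.

Set Implicit Arguments.
Unset Strict Implicit.
Unset Printing Implicit Defensive.
Import Order.TTheory GRing.Theory.
Local Open Scope ring_scope.
Local Open Scope complex_scope.

(** Write [f] and [g] for the coefficient sequences of the two series.  The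
    recursion defining the words can be read as a substitution: with
    [twist v] the concatenation of the pairs [(-1) ^+ m.+1] times
    [(v_m, 1)], each odd-indexed word is the twist of the preceding word, and
    each even-indexed word is [1, 1] followed by the twist of the preceding
    word ([word_twist]).  In the limit this expresses [f] and [g] through each
    other at half the index, and applying it twice shows that both are Toeplitz
    sequences: [f (4m+2) = (-1)^m f m] and [g (4m+4) = (-1)^m g m], all other
    entries being 8-periodic up to the initial ones.  Hence
    [F(x) = x^2 F(-x^4) + A(x)] and [G(x) = x^4 G(-x^4) + B(x)] with [A], [B]
    rational ([toeplitz_mahler]).

    Let [sigma] be the substitution [x -> -x^4] on rational functions and [tau]
    the same substitution on Laurent series.  An algebraic relation of minimal
    leading monomial, made monic, is preserved up to a factor by the operation
    that applies [sigma] to its coefficients and replaces [X_i] by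
    [(X_i - alpha_i) / u_i], where [u_i] is [x^2] or [x^4].  In top degree this
    says that quotients of coefficients are twisted constants, solutions of
    [x^a h = x^b tau(h)].  Since the order of [tau(h)] is four times that of
    [h], a nonzero solution requires [a = b] modulo 3; the exponents 0, 2, 4 are
    distinct modulo 3, so there is none, and only the leading monomial
    contributes to the equation that is found one degree lower.  This equation
    provides a nonzero multiple of [F] or of [G], plus a rational function, that
    is itself a twisted constant, hence zero ([difference_alg_independent]).

    So it remains to see that [F] and [G] are irrational.  At each scale [4^k] a
    Toeplitz sequence is periodic except on one residue class modulo [4^k],
    where shifting by the period changes infinitely many signs.  A linear
    recurrence of length less than [4^k] sees at most one such exception, so
    comparing it with its own shift kills its leading coefficient
    ([toeplitz_irrational]). *)

(** * The words as iterated substitutions *)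

(** The sign alternates from one pair to the next, which is what the negation
    of the recursive call encodes. *)
Fixpoint twist (v : seq int) : seq int :=
  if v is a :: v' then [:: - a, -1 & map -%R (twist v')] else [::].

Lemma twist_cons a v : twist (a :: v) = [:: - a, -1 & map -%R (twist v)].
Proof. by []. Qed.

Lemma size_twist v : size (twist v) = (size v).*2.
Proof. by elim: v => //= a v IHv; rewrite size_map IHv. Qed.

Lemma even_seq_ind (T : Type) (P : seq T -> Prop) :
    P [::] ->
    (forall a b s, ~~ odd (size s) -> P s -> P [:: a, b & s]) ->
  forall s, ~~ odd (size s) -> P s.
Proof.
move=> P0 P2 s; have [n] := ubnP (size s).
elim: n s => // n IHn [|a [|b s]] //= lt_s; rewrite negbK => even_s.
by apply: P2 => //; apply: IHn; rewrite // -ltnS ltnW.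
Qed.

Lemma twist2 a b v : twist [:: a, b & v] = [:: - a, -1, b, 1 & twist v].
Proof. by rewrite /= !opprK (mapK (@opprK _)). Qed.

Lemma twist_cat v1 v2 :
  ~~ odd (size v1) -> twist (v1 ++ v2) = twist v1 ++ twist v2.
Proof.
move: v1; apply: (@even_seq_ind _ (fun v => twist (v ++ v2) = twist v ++ _)) => //.
move=> a b s _ IHs.
by rewrite twist2 !cat_cons twist2 IHs.
Qed.

(** Reversal exchanges the roles of the two entries in each pair of a twist; up
    to one extra letter at an end this is again a twist, because half of its
    letters strictly alternate in sign. *)
Lemma rev_twist v : ~~ odd (size v) ->
  map -%R (rev (twist v)) ++ [:: -1] = -1 :: map -%R (twist (map -%R (rev v))).
Proof.
move: v; apply: (@even_seq_ind _ (fun v => _ = -1 :: map _ (twist (map _ (rev v))))) => //.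
move=> a b s even_s IHs.
have even_r : ~~ odd (size (map -%R (rev s))) by rewrite size_map size_rev.
rewrite twist2 -[[:: a, b & s]]/([:: a; b] ++ s) rev_cat map_cat twist_cat //.
rewrite map_cat -cat_cons -IHs.
rewrite -[[:: - a, -1, b, 1 & _]]/([:: - a; -1; b; 1] ++ _).
by rewrite rev_cat map_cat -!catA /= !opprK.
Qed.

Lemma size_word_even n : ~~ odd (size (word n)).
Proof.
suff: ~~ odd (size (word n)) && ~~ odd (size (word n.+1)) by case/andP.
elim: n => // n /andP[even_n even_n1]; rewrite even_n1 wE !size_cat size_map size_rev.
by rewrite !oddD /= (negbTE even_n1) (negbTE even_n).
Qed.

Lemma wordS2 n : word n.+2 =
  word n ++ (-1) ^+ n :: map -%R (rev (word n)) ++ (-1) ^+ n :: word n.+1.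
Proof. by rewrite wE exprSr exprSr mulrN1 mulrN1 opprK. Qed.

(** The twist carries the factors in the recursive description of a word to those
    of the next word, except that the separating letters become pairs;
    [rev_twist] absorbs the letters in excess.  Evenness of all lengths keeps the
    signs of the factors aligned. *)
Lemma word_twist p :
  word (2 * p).+1 = twist (word (2 * p)) /\
  word (2 * p).+2 = [:: 1, 1 & twist (word (2 * p).+1)].
Proof.
have sgn_even q : (-1) ^+ (2 * q) = 1%R :> int by rewrite exprM sqrrN !expr1n.
have sgn_odd q : (-1) ^+ (2 * q).+1 = (-1)%R :> int by rewrite exprS sgn_even mulr1.
elim: p => // p [IHo IHe]; rewrite mulnS add2n.
have odd_step : word (2 * p).+3 = twist (word (2 * p).+2).
  have even_v := size_word_even (2 * p).
  rewrite wordS2 [in RHS]wordS2 sgn_even sgn_odd IHe {1 2}IHo twist_cat //.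
  congr (_ ++ _); rewrite -cat1s catA -[in RHS]cat1s /= twist_cat ?size_map ?size_rev //=.
  rewrite map_cat /= (mapK opprK) !opprK -[in RHS]cat_cons -rev_twist //.
  by rewrite -catA.
split=> //; have even_v := size_word_even (2 * p).+1.
rewrite wordS2 [in RHS]wordS2 odd_step {1 2}IHe sgn_odd exprS sgn_odd mulrN1 opprK.
rewrite twist_cat // twist_cons opprK !cat_cons; congr [:: _, _ & _ ++ _ :: _].
move: (word _.+1) (word _.+2) even_v => v u even_v.
rewrite twist_cat ?size_map ?size_rev // twist_cons map_cat /=.
rewrite (mapK (@opprK _)) !opprK -[RHS]cat_cons -rev_twist //.
rewrite -[[:: 1, 1 & _]]/([:: 1; 1] ++ _) rev_cat map_cat.
by rewrite -!catA.
Qed.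

(** * Recurrences for the coefficients of the two limit series *)

Lemma nth_twist_even v m : (twist v)`_(2 * m) = (-1) ^+ m.+1 * v`_m.
Proof.
elim: v m => [|a v IHv] [|m]; rewrite ?nth_nil ?mulr0 ?muln0 ?mulN1r //.
rewrite mulnS add2n twist_cons /=.
have [le_v|lt_v] := leqP (size (twist v)) (2 * m).
  rewrite !nth_default ?size_map ?mulr0 //.
  by rewrite size_twist -mul2n leq_pmul2l in le_v.
by rewrite (nth_map 0) // IHv [in RHS]exprS mulN1r mulNr.
Qed.

Lemma nth_twist_odd v m :
  (m < size v)%N -> (twist v)`_(2 * m).+1 = (-1) ^+ m.+1.
Proof.
elim: v m => [|a v IHv] [|m] // lt_m.
rewrite mulnS add2n twist_cons /= (nth_map 0) ?IHv // ?[RHS]exprS ?mulN1r //.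
by rewrite size_twist -mul2n; move: lt_m => /=; lia.
Qed.

Lemma coef_GF (K : nzRingType) s m : (GF K s)`_m = (s`_m)%:~R.
Proof.
rewrite /GF coef_Poly; have [le_s|lt_s] := leqP (size s) m.
  by rewrite !nth_default ?size_map.
by rewrite (nth_map 0).
Qed.

Lemma fps_cvg_prefix (K : Type) (u : nat -> fps K) (f : fps K) : fps_cvg u f ->
  forall M, exists N, forall n, (N <= n)%N ->
  forall m, (m < M)%N -> coefs (u n) m = coefs f m.
Proof.
move=> uf; elim=> [|M [N fN]]; first by exists 0%N.
have [N' fM] := uf M; exists (maxn N N') => n.
rewrite geq_max => /andP[le_N le_N'] m; rewrite ltnS leq_eqVlt => /predU1P[->|].
  exact: fM.
exact: fN.
Qed.

Section Coefficients.
Variable K : comNzRingType.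
Local Notation f := (coefs (calF K)).
Local Notation g := (coefs (calG K)).

(** One index [n] serves the words [2n], [2n+1] and [2n+2] at once, so that
    [word_twist] passes to the limit. *)
Lemma calFG_words M : exists n,
  [/\ (M <= size (word (2 * n)))%N, (M <= size (word (2 * n).+1))%N &
    forall m, (m < M)%N ->
    [/\ f m = ((word (2 * n))`_m)%:~R, f m = ((word (2 * n).+2)`_m)%:~R &
        g m = ((word (2 * n).+1)`_m)%:~R]].
Proof.
have [N fN] := fps_cvg_prefix (calF_cvg K) M.
have [N' gN] := fps_cvg_prefix (calG_cvg K) M.
pose n := maxn M (maxn N N'); exists n.
have [le_M le_N le_N'] : [/\ M <= n, N <= n & N' <= n]%N.
  by split; rewrite !leq_max leqnn ?orbT.
split; first exact: leq_trans (size_w 0 n).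
  exact: leq_trans (size_w 1 n).
move=> m lt_m; rewrite -[(2 * n).+2]/(2 + 2 * n)%N -mulnS -[(2 * n).+1]addn1 -!coef_GF.
by split; [rewrite -(fN n) | rewrite -(fN n.+1) ?leqW | rewrite -(gN n)].
Qed.

Lemma calG_even m : g (2 * m) = (-1) ^+ m.+1 * f m.
Proof.
have [n [_ _ fgn]] := calFG_words (2 * m).+1.
have [_ _ ->] := fgn (2 * m)%N (ltnSn _).
have [| -> _ _] := fgn m; first lia.
by rewrite (word_twist n).1 nth_twist_even rmorphM rmorphXn rmorphN1.
Qed.

Lemma calG_odd m : g (2 * m).+1 = (-1) ^+ m.+1.
Proof.
have [n [le_n _ fgn]] := calFG_words (2 * m).+2.
have [_ _ ->] := fgn (2 * m).+1 (ltnSn _).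
by rewrite (word_twist n).1 nth_twist_odd ?rmorphXn ?rmorphN1 //; lia.
Qed.

Lemma calF_0 : f 0 = 1.
Proof.
have [n [_ _ fgn]] := calFG_words 1.
by have [_ ->] := fgn 0%N isT; rewrite (word_twist n).2.
Qed.

Lemma calF_1 : f 1 = 1.
Proof.
have [n [_ _ fgn]] := calFG_words 2.
by have [_ ->] := fgn 1%N isT; rewrite (word_twist n).2.
Qed.

Lemma calF_even m : f (2 * m).+2 = (-1) ^+ m.+1 * g m.
Proof.
have [n [_ _ fgn]] := calFG_words (2 * m).+3.
have [_ -> _] := fgn (2 * m).+2 (ltnSn _).
have [| _ _ ->] := fgn m; first lia.
by rewrite (word_twist n).2 /= nth_twist_even rmorphM rmorphXn rmorphN1.
Qed.

Lemma calF_odd m : f (2 * m).+3 = (-1) ^+ m.+1.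
Proof.
have [n [_ le_n fgn]] := calFG_words (2 * m).+4.
have [_ -> _] := fgn (2 * m).+3 (ltnSn _).
rewrite (word_twist n).2 -[_`__]/((twist (word (2 * n).+1))`_(2 * m).+1).
by rewrite nth_twist_odd ?rmorphXn ?rmorphN1 //; lia.
Qed.

End Coefficients.

(** * Irrationality of Toeplitz sequences *)

Section Toeplitz.
Variables (K : fieldType) (c : nat) (a : nat -> K).

(** The class of [c] modulo 4 carries a signed copy of the whole sequence, the
    other classes are periodic from [c] on.  The alternation at odd indices is what makes the
    sequence differ from its shift by 2, hence aperiodic. *)
Record toeplitz : Prop := Toeplitz {
  toeplitz_self m : a (4 * m + c)%N = (-1) ^+ m * a m;
  toeplitz_per n : (c <= n)%N -> n != c %[mod 4] -> a (n + 8)%N = a n;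
  toeplitz_odd m : a (2 * m).+1 = (-1) ^+ m * a 1;
  toeplitz_neq0 : a 1 != 0 }.

Hypothesis aT : toeplitz.

(** After [k] steps of filling, the only places still open are those congruent
    to [hole k] modulo [4 ^ k]. *)
Fixpoint hole k := if k is k'.+1 then (4 * hole k' + c)%N else 0%N.

Lemma toeplitz_period k n : (hole k <= n)%N -> n != hole k %[mod 4 ^ k] ->
  a (n + 2 * 4 ^ k)%N = a n.
Proof.
elim: k n => [|k IHk] n le_n; first by rewrite !modn1 eqxx.
move: le_n => /= le_n neq_n; have le_cn : (c <= n)%N by lia.
have [eq_n|/eqP neq_n4] := eqVneq (n %% 4)%N (c %% 4)%N; last first.
  rewrite (_ : 2 * 4 ^ k.+1 = 4 ^ k * 8)%N; last by rewrite expnS; lia.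
  elim: (4 ^ k)%N => [|t IHt]; first by rewrite addn0.
  rewrite (_ : n + _ = n + t * 8 + 8)%N; last by lia.
  rewrite (toeplitz_per aT) //; first lia.
  by apply/eqP; lia.
have [m def_n] : exists m, n = (4 * m + c)%N by exists ((n - c) %/ 4)%N; lia.
rewrite def_n (_ : _ + _ = 4 * (m + 2 * 4 ^ k) + c)%N; last by rewrite expnS; lia.
rewrite !(toeplitz_self aT) exprD exprM sqrrN expr1n expr1n mulr1 IHk //; first lia.
apply: contra neq_n; rewrite def_n expnS => /eqP eq_m; rewrite eqn_modDr.
by rewrite -!muln_modr eq_m.
Qed.

(** In the holes the sequence is, up to signs unaffected by the shift, the
    sequence itself, and the shift by [2 * 4 ^ k] becomes the shift by 2. *)
Lemma toeplitz_hole k m : odd m ->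
  a (hole k + 4 ^ k * m + 2 * 4 ^ k)%N = - a (hole k + 4 ^ k * m)%N /\
  a (hole k + 4 ^ k * m)%N != 0.
Proof.
move=> odd_m; elim: k => [|k [IHk neq0]] /=.
  rewrite !mul1n add0n muln1.
  have -> : m = (2 * m./2).+1 by lia.
  rewrite (_ : _ + _ = (2 * (m./2).+1).+1)%N; last by lia.
  rewrite !(toeplitz_odd aT) exprS mulN1r mulNr; split=> //.
  by rewrite mulf_neq0 ?signr_eq0 ?(toeplitz_neq0 aT).
rewrite expnS (_ : _ + _ = 4 * (hole k + 4 ^ k * m + 2 * 4 ^ k) + c)%N; last by lia.
rewrite (_ : 4 * hole k + c + _ = 4 * (hole k + 4 ^ k * m) + c)%N; last by lia.
rewrite !(toeplitz_self aT) IHk exprD exprM sqrrN expr1n expr1n mulr1 mulrN; split=> //.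
by rewrite mulf_neq0 ?signr_eq0.
Qed.

Lemma coef_mul_poly_fps (q : {poly K}) d n : (size q <= d.+1)%N -> (d <= n)%N ->
  coefs (fps_of_poly q * FPS a) n = \sum_(0 <= i < d.+1) q`_i * a (n - i).
Proof.
move=> le_q le_d /=; rewrite -(big_mkord xpredT (fun i => q`_i * a (n - i))).
rewrite (big_cat_nat _ (n := d.+1)) //= [X in _ + X]big_nat_cond [X in _ + X]big1 ?addr0 //.
move=> i /andP[/andP[lt_i _] _]; rewrite nth_default ?mul0r //.
exact: leq_trans lt_i.
Qed.

(** The denominator [q] gives a linear recurrence of length [size q].  At the
    scale where [4 ^ k] exceeds that length, place the window so that its
    earliest entry, the one multiplied by the leading coefficient of [q], is in a hole:
    subtracting the recurrence from its shift by [2 * 4 ^ k] leaves twice the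
    leading coefficient times a nonzero entry. *)
Lemma toeplitz_irrational (p q : {poly K}) : (2%:R : K) != 0 ->
  fps_of_poly q * FPS a = fps_of_poly p -> q = 0.
Proof.
move=> nz2 qa; apply/eqP/negPn/negP => nz_q.
(* m is odd, so that the entry changes sign, and large, so that the
   recurrence already holds there. *)
pose d := (size q).-1; pose k := size q; pose m := (2 * size p).+1.
have size_q : size q = d.+1 by rewrite prednK // lt0n size_poly_eq0.
have lt_d4 : (d < 4 ^ k)%N by rewrite -size_q; apply/ltnW/ltn_expl.
have odd_m : odd m by rewrite /m; lia.
have [shift_m nz_m] := toeplitz_hole k odd_m.
pose n := (hole k + 4 ^ k * m + d)%N.
have le_m : (size p <= 4 ^ k * m)%N by rewrite (leq_trans _ (leq_pmull _ _)) ?expn_gt0 // /m; lia.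
have zero_qa n' : (size p <= n')%N -> (d <= n')%N ->
    \sum_(0 <= i < d.+1) q`_i * a (n' - i) = 0.
  by move=> le_p le_d; rewrite -coef_mul_poly_fps ?size_q // qa /= nth_default.
have le_dn : (d <= n)%N by rewrite leq_addl.
have le_pn : (size p <= n)%N by rewrite (leq_trans le_m) // /n; lia.
(* Only the term of index d survives in the difference of the two windows. *)
have shift_qa := zero_qa _ (leq_trans le_pn (leq_addr (2 * 4 ^ k) n))
  (leq_trans le_dn (leq_addr _ _)).
have /eqP := f_equal2 (fun x y : K => x - y) shift_qa (zero_qa n le_pn le_dn).
rewrite subrr -sumrB big_nat_recr //=.
rewrite big_nat big1 ?add0r => [|i /= lt_i].
  rewrite -mulrBr mulf_eq0; apply/negP; rewrite negb_or -lead_coefE lead_coef_eq0 nz_q /=.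
  rewrite /n addnAC !addnK shift_m -opprD oppr_eq0 -mulr2n -mulr_natl mulf_neq0 //.
rewrite -mulrBr (_ : n + 2 * 4 ^ k - i = n - i + 2 * 4 ^ k)%N; last by lia.
rewrite (_ : n - i = hole k + 4 ^ k * m + (d - i))%N; last by rewrite /n; lia.
rewrite toeplitz_period ?subrr ?mulr0 //; first lia.
rewrite -addnA -[X in _ != X %[mod _]]addn0 eqn_modDl.
rewrite mulnC modnMDl mod0n modn_small ?(leq_ltn_trans (leq_subr _ _)) //; lia.
Qed.
End Toeplitz.

(** * The two limit series are Toeplitz *)

Section CalFG.
Variable K : fieldType.

Lemma calF_toeplitz : toeplitz 2 (coefs (calF K)).
Proof.
have F_odd m : coefs (calF K) (2 * m).+1 = (-1) ^+ m.
  by case: m => [|m]; rewrite ?muln0 ?calF_1 // mulnS add2n calF_odd.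
split=> [m|n le_n neq_n|m|]; rewrite ?F_odd ?calF_1 ?mulr1 ?oner_neq0 //.
  rewrite (_ : 4 * m + 2 = (2 * (2 * m)).+2)%N; last by lia.
  by rewrite calF_even calG_even !exprS exprM sqrrN !expr1n; ring.
have [odd_n|even_n] := boolP (odd n).
  have -> : n = (2 * n./2).+1 by lia.
  rewrite (_ : (2 * n./2).+1 + 8 = (2 * (n./2 + 4)).+1)%N; last by lia.
  by rewrite !F_odd exprD; ring.
pose j := (n %/ 4).-1; have -> : n = (2 * (2 * j).+1).+2 by rewrite /j; lia.
rewrite (_ : (2 * (2 * j).+1).+2 + 8 = (2 * (2 * j.+2).+1).+2)%N; last by lia.
by rewrite !calF_even !calG_odd (_ : 2 * j.+2 = 2 * j + 4)%N ?exprS ?exprD; first ring; lia.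
Qed.

Lemma calG_toeplitz : toeplitz 4 (coefs (calG K)).
Proof.
have G_1 : coefs (calG K) 1 = -1 by rewrite (calG_odd K 0).
split=> [m|n le_n neq_n|m|]; rewrite ?G_1 ?oppr_eq0 ?oner_neq0 //.
- rewrite (_ : 4 * m + 4 = 2 * (2 * m).+2)%N; last by lia.
  rewrite calG_even calF_even !exprS exprM sqrrN !expr1n; ring.
- have [odd_n|even_n] := boolP (odd n).
    have -> : n = (2 * n./2).+1 by lia.
    rewrite (_ : (2 * n./2).+1 + 8 = (2 * (n./2 + 4)).+1)%N; last by lia.
    by rewrite !calG_odd !exprS !exprD; ring.
  pose j := (n %/ 4).-1; have -> : n = (2 * (2 * j).+3)%N by rewrite /j; lia.
  rewrite (_ : 2 * (2 * j).+3 + 8 = 2 * (2 * j.+2).+3)%N; last by lia.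
  by rewrite !calG_even !calF_odd (_ : 2 * j.+2 = 2 * j + 4)%N ?exprS ?exprD; first ring; lia.
by rewrite calG_odd exprS; ring.
Qed.

End CalFG.

(** * Translating the variables of a polynomial *)

Section Shift.
Variables (n : nat) (R : idomainType) (s : 'I_n -> R).
Implicit Types p q : {mpoly R[n]}.

Definition mshift p := p \mPo [tuple 'X_i - (s i)%:MP_[n] | i < n].
Definition mderiv_along p := \sum_i s i *: p^`M(i).

(** The remainder of the first-order Taylor expansion: it lowers the total degree
    by at least 2 ([mcoeff_shift_errorX]). *)
Definition shift_error p := mshift p - p + mderiv_along p.

Lemma shift_error_is_linear : linear shift_error.
Proof.
move=> c p q; rewrite /shift_error /mshift /mderiv_along linearP /=.
under eq_bigr do rewrite linearP /= scalerDr scalerA mulrC -scalerA.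
by rewrite big_split /= -scaler_sumr !scalerDr scalerN opprD; ring.
Qed.
HB.instance Definition _ := GRing.isLinear.Build R {mpoly R[n]} {mpoly R[n]} _
  shift_error shift_error_is_linear.

Lemma mcoeff_deriv_along p m :
  (mderiv_along p)@_m = \sum_i s i * (p@_(m + U_(i)) *+ (m i).+1).
Proof.
by rewrite linear_sum /=; apply: eq_bigr => i _; rewrite mcoeffZ mcoeff_deriv.
Qed.

(** By induction on the monomial: multiplying by [X_i] changes the remainder into
    itself times [X_i - s_i], plus [s_i] times a derivative, and neither exceeds
    the allowed degree. *)
Lemma mcoeff_shift_errorX k m :
  (mdeg k <= (mdeg m).+1)%N -> (shift_error 'X_[k])@_m = 0.
Proof.
have [d] := ubnP (mdeg k); elim: d k m => // d IHd k m.
have [-> _ _|] := eqVneq k 0%MM.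
  rewrite /shift_error /mshift mpolyX0 rmorph1 subrr add0r mcoeff_deriv_along.
  by rewrite big1 // => i _; rewrite mcoeff1 mnmD_eq0 mnm1_eq0 andbF mul0rn mulr0.
move=> nz_k lt_k le_k; have [i ki] : exists i, k i != 0%N.
  apply/existsP; apply: contraR nz_k; rewrite negb_exists => /forallP k0.
  by apply/eqP/mnmP => i; rewrite mnm0E; apply/eqP/negPn.
have def_k : k = (k - U_(i) + U_(i))%MM by rewrite submK // lep1mP.
move: (k - U_(i))%MM def_k lt_k le_k => k' -> {k nz_k ki}.
rewrite mdegD mdeg1 addn1 !ltnS => lt_k' le_k'.
have -> : shift_error 'X_[k' + U_(i)] = shift_error 'X_[k'] * 'X_i
    - s i *: shift_error 'X_[k'] + s i *: mderiv_along 'X_[k'].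
  rewrite /shift_error /mshift mpolyXD rmorphM /= comp_mpolyXU -tnth_nth tnth_mktuple.
  have -> : mderiv_along ('X_[k'] * 'X_i) = mderiv_along 'X_[k'] * 'X_i + s i *: 'X_[k'].
    rewrite /mderiv_along mulr_suml (eq_bigr (fun j => s j *: ('X_[k'])^`M(j) * 'X_i
      + s j *: ('X_[k'] * ('X_i)^`M(j)))); last first.
      by move=> j _; rewrite mderivM scalerDr scalerAl.
    rewrite big_split /=; congr (_ + _); rewrite (bigD1 i) //= big1 ?addr0.
      by rewrite mderivX mnm1E eqxx -[X in (X - _)%MM]add0m addmK mpolyX0 scale1r mulr1.
    move=> j neq_ji; rewrite mderivX mnm1E eq_sym (negbTE neq_ji) scale0r.
    by rewrite mulr0 scaler0.
  rewrite -!mul_mpolyC; ring.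
rewrite !mcoeffD mcoeffN !mcoeffZ [X in _ - _ * X]IHd //; last exact: leqW.
rewrite mcoeff_deriv_along [X in _ + _ * X]big1 => [|j _]; last first.
  rewrite mcoeffX (_ : (_ == _) = false) ?mul0rn ?mulr0 //.
  by apply: contraTF le_k' => /eqP ->; rewrite mdegD mdeg1 addn1 ltnn.
rewrite !mulr0 subr0 addr0; apply/eqP; rewrite mcoeff_eq0 (perm_mem (msuppMX _ _)).
apply/mapP => -[m' m'_supp def_m]; move: m'_supp.
rewrite mcoeff_msupp IHd ?eqxx //.
by move: le_k'; rewrite def_m mdegD mdeg1 add1n.
Qed.

Lemma mcoeff_shift_error p m :
    (forall k, ((mdeg m).+1 < mdeg k)%N -> p@_k = 0) ->
  (shift_error p)@_m = 0.
Proof.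
move=> p0; rewrite [p]mpolyE !linear_sum big_seq big1 //= => k.
rewrite mcoeff_msupp => nz_k; rewrite !linearZ /= mcoeff_shift_errorX ?mulr0 //.
by rewrite leqNgt; apply: contra nz_k => /p0 ->.
Qed.

Lemma mcoeff_shift p m :
    (forall k, ((mdeg m).+1 < mdeg k)%N -> p@_k = 0) ->
  (mshift p)@_m = p@_m - \sum_i s i * (p@_(m + U_(i)) *+ (m i).+1).
Proof.
move=> p0; rewrite -mcoeff_deriv_along -mcoeffB; apply/eqP.
by rewrite -subr_eq0 -mcoeffB opprB [_ - p]addrC addrA mcoeff_shift_error.
Qed.
End Shift.

(** * Algebraic independence over a difference field *)

Lemma mmap_comp_mpoly (n k : nat) (K L : comNzRingType)
    (iota : {rmorphism K -> L}) (h : 'I_k -> L)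
    (lq : n.-tuple {mpoly K[k]}) (p : {mpoly K[n]}) :
  mmap iota h (p \mPo lq) = mmap iota (fun i => mmap iota h (tnth lq i)) p.
Proof.
elim/mpolyind: p => [|c m p _ _ IHp]; first by rewrite !rmorph0.
rewrite comp_mpolyD comp_mpolyZ !mmapD !mmapZ IHp mmapX comp_mpolyX rmorph_prod /=.
by under eq_bigr do rewrite rmorphXn.
Qed.

Lemma mmap_map_mpoly (n : nat) (K L : comNzRingType)
    (iota : {rmorphism K -> L}) (sigma : {rmorphism K -> K})
    (tau : {rmorphism L -> L}) (h : 'I_n -> L) (p : {mpoly K[n]}) :
    (forall x, tau (iota x) = iota (sigma x)) ->
  mmap iota (tau \o h) (map_mpoly sigma p) = tau (mmap iota h p).
Proof.
move=> iotaE; elim/mpolyind: p => [|c m p _ _ IHp]; first by rewrite !rmorph0.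
rewrite rmorphD /= map_mpolyZ map_mpolyX !mmapD !mmapZ !mmapX IHp rmorphD rmorphM.
by rewrite iotaE /mmap1 rmorph_prod; under [in RHS]eq_bigr do rewrite rmorphXn.
Qed.

Lemma mcoeff_scale_vars (n : nat) (R : comNzRingType) (v : 'I_n -> R)
    (p : {mpoly R[n]}) m :
  (p \mPo [tuple v i *: 'X_i | i < n])@_m = p@_m * \prod_i v i ^+ m i.
Proof.
elim/mpolyind: p => [|c k p _ _ IHp]; first by rewrite rmorph0 !mcoeff0 mul0r.
rewrite comp_mpolyD comp_mpolyZ !mcoeffD !mcoeffZ IHp mulrDl; congr (_ + _).
rewrite comp_mpolyX -mulrA; congr (_ * _).
rewrite (eq_bigr (fun i => v i ^+ k i *: 'X_i ^+ k i)); last first.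
  by move=> i _; rewrite tnth_mktuple exprZn.
rewrite scaler_prod -mpolyXE_id mcoeffZ mcoeffX mulrC.
by case: eqP => [->|]; rewrite ?mul0r.
Qed.

Section DifferenceFields.
Variables (K L : fieldType) (iota : {rmorphism K -> L}).
Variables (sigma : {rmorphism K -> K}) (tau : {rmorphism L -> L}).
Hypothesis iotaE : forall x, tau (iota x) = iota (sigma x).
Variables (n : nat) (f : 'I_n -> L) (u alpha : 'I_n -> K).
Hypothesis u_neq0 : forall i, u i != 0.
Hypothesis fE : forall i, f i = iota (u i) * tau (f i) + iota (alpha i).

(** The functional equations give [tau (f i) = (f i - alpha i) / u i], so
    [transport] turns relations among the [f i] into relations
    ([mmap_transport]). *)
Definition transport (P : {mpoly K[n]}) : {mpoly K[n]} :=
  mshift alpha (map_mpoly sigma P \mPo [tuple (u i)^-1 *: 'X_i | i < n]).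

(** The factor by which [transport] multiplies the coefficient of [m] in top
    degree, besides applying [sigma]. *)
Definition weight (m : 'X_{1..n}) : K := \prod_i (u i)^-1 ^+ m i.

Lemma mmap_transport P : mmap iota f (transport P) = tau (mmap iota f P).
Proof.
rewrite /transport /mshift !mmap_comp_mpoly -(mmap_map_mpoly _ _ iotaE).
apply: eq_bigr => m _; congr (_ * _); apply: mmap1_eq => i /=.
rewrite tnth_mktuple mmapZ mmapX mmap1U tnth_mktuple mmapB mmapX mmapC mmap1U.
by rewrite {1}fE addrK mulrA -rmorphM mulVf // rmorph1 mul1r.
Qed.

Lemma mcoeff_transport P m :
    (forall k, ((mdeg m).+1 < mdeg k)%N -> P@_k = 0) ->
  (transport P)@_m = sigma P@_m * weight m
    - \sum_i alpha i * (sigma P@_(m + U_(i)) * weight (m + U_(i)) *+ (m i).+1).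
Proof.
move=> P0; rewrite mcoeff_shift => [|k /P0 Pk].
  rewrite mcoeff_scale_vars mcoeff_map_mpoly; congr (_ - _); apply: eq_bigr => i _.
  by rewrite mcoeff_scale_vars mcoeff_map_mpoly.
by rewrite mcoeff_scale_vars mcoeff_map_mpoly Pk raddf0 mul0r.
Qed.

Lemma weightD m1 m2 : weight (m1 + m2) = weight m1 * weight m2.
Proof. by rewrite -big_split; apply: eq_bigr => i _; rewrite mnmDE exprD. Qed.

Lemma weightU i : weight U_(i) = (u i)^-1.
Proof.
rewrite /weight (bigD1 i) //= mnm1E eqxx big1 ?mulr1 // => j neq_ji.
by rewrite mnm1E eq_sym (negbTE neq_ji).
Qed.

Lemma weight_neq0 m : weight m != 0.
Proof. by apply/prodf_neq0 => i _; rewrite expf_neq0 ?invr_eq0. Qed.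

(** A minimal monic relation [P] is proportional to its transport.  Let [m] be its
    leading monomial divided by one of the variables, [X_i0].  In top degree, the
    coefficient of [m] times another variable [X_i] solves
    [u i * e = u i0 * sigma e], so it vanishes.  Comparing the coefficients of
    [m] itself then shows that a nonzero multiple of [f i0] plus the coefficient
    of [m] in [P] solves [h = u i0 * tau h]. *)
Theorem difference_alg_independent :
    [pchar K] =i pred0 ->
    (forall i h, h = iota (u i) * tau h -> h = 0) ->
    (forall i j e, i != j -> u j * e = u i * sigma e -> e = 0) ->
    (forall i x, f i <> iota x) ->
  alg_independent iota f.
Proof.
move=> charK fixL fixK f_notin P.
have [m0] : exists m0, mlead P = m0 by exists (mlead P).
elim/(@ltmwf n): m0 P => m0 IHm P def_m0 P_f; apply/eqP/negPn/negP => nz_P.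
wlog P_monic : P def_m0 P_f nz_P / P@_m0 = 1.
  have nz_c : P@_m0 != 0 by rewrite -def_m0 mleadc_eq0.
  move/(_ ((P@_m0)^-1 *: P)); apply; rewrite ?mleadZ ?invr_eq0 //.
  - by rewrite mmapZ P_f mulr0.
  - by rewrite scaler_eq0 invr_eq0 (negbTE nz_c).
  by rewrite mcoeffZ mulVf.
have P_gt m : (m0 < m)%O -> P@_m = 0.
  move=> lt_m; apply/eqP; rewrite mcoeff_eq0; apply/negP => /msupp_le_mlead.
  by rewrite def_m0 leNgt lt_m.
have P_deg m : (mdeg m0 < mdeg m)%N -> P@_m = 0 by move/lt_mdeg_ltmc/P_gt.
have coef_top m : (mdeg m0 <= mdeg m)%N ->
    (transport P)@_m = sigma P@_m * weight m.
  move=> le_m; rewrite mcoeff_transport => [|k lt_k].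
    rewrite big1 ?subr0 // => i _; rewrite P_deg ?rmorph0 ?mul0r ?mul0rn ?mulr0 //.
    by rewrite mdegD mdeg1 addn1 ltnS.
  by rewrite P_deg // (leq_ltn_trans le_m) // ltnW.
(* The difference is a relation with a smaller leading monomial. *)
have transportE : transport P = weight m0 *: P.
  apply/eqP; rewrite -subr_eq0; apply/eqP.
  set D := _ - _; apply: contraTeq isT => nz_D; have /(IHm _) D0 : (mlead D < m0)%O.
    rewrite ltNge; apply: contraNN nz_D => le_m0.
    rewrite -mleadc_eq0 mcoeffB mcoeffZ coef_top ?lemc_mdeg //.
    move: le_m0; rewrite le_eqVlt => /predU1P[<-|/P_gt ->].
      by rewrite P_monic rmorph1 mulrC subrr.
    by rewrite rmorph0 mul0r mulr0 subrr.
  have: D = 0 by apply: (D0 D); rewrite // mmapB mmapZ mmap_transport P_f rmorph0 mulr0 subr0.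
  by move/eqP; rewrite (negbTE nz_D).
have [i0 m0i0] : exists i, m0 i != 0%N.
  apply/existsP; apply: contraR nz_P; rewrite negb_exists => /forallP k0.
  have def0 : m0 = 0%MM by apply/mnmP => i; rewrite mnm0E; apply/eqP/negPn.
  have P1 : P = 1.
    apply/mpolyP => m; rewrite mcoeff1; have [->|nz_m] := eqVneq m 0%MM.
      by rewrite -def0 P_monic.
    by apply: P_deg; rewrite def0 mdeg0 lt0n mdeg_eq0.
  by move/eqP: P_f; rewrite P1 rmorph1 oner_eq0.
pose m := (m0 - U_(i0))%MM; have def_m : m0 = (m + U_(i0))%MM.
  by rewrite submK // lep1mP.
have deg_m : (mdeg m).+1 = mdeg m0 by rewrite def_m mdegD mdeg1 addn1.
have P_side i : i != i0 -> P@_(m + U_(i)) = 0.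
  move=> neq_i; apply: (fixK i0 i); first by rewrite eq_sym.
  have := coef_top (m + U_(i))%MM; rewrite mdegD mdeg1 addn1 deg_m => /(_ (leqnn _)).
  rewrite transportE mcoeffZ def_m !weightD !weightU => e_i.
  apply: (mulfI (weight_neq0 m)); move: e_i => /(congr1 ( *%R (u i * u i0))).
  have [ui ui0] := (u_neq0 i, u_neq0 i0).
  move: (P@_ _) (weight m) => e w.
  have cancel (a b y z : K) : b != 0 -> a * b * (y / b * z) = y * (a * z).
    by move=> nz_b; field.
  by rewrite cancel // => ->; rewrite [sigma e * _]mulrC [u i * u i0]mulrC cancel.
have coef_m : (transport P)@_m = weight m0 * P@_m by rewrite transportE mcoeffZ.
have {coef_m} : u i0 * sigma P@_m - alpha i0 *+ (m i0).+1 = P@_m.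
  move: coef_m; rewrite mcoeff_transport => [|k lt_k]; last by rewrite P_deg // -deg_m.
  rewrite (bigD1 i0) //= big1 => [|i neq_i]; last first.
    by rewrite P_side // rmorph0 mul0r mul0rn mulr0.
  rewrite -def_m P_monic rmorph1 mul1r addr0 def_m weightD weightU => e_m.
  apply: (mulfI (weight_neq0 m)); move: e_m => /(congr1 ( *%R (u i0))).
  have ui0 := u_neq0 i0; move: (P@_ _) (weight m) => p w.
  rewrite -[w / _ *+ _]mulr_natr -[alpha i0 *+ _]mulr_natr.
  have cancel (b y z : K) : b != 0 -> b * (y / b * z) = y * z.
    by move=> nz_b; field.
  by rewrite cancel // => <-; field.
set N := (m i0).+1; set p := P@_m => pE.
have NK : N%:R != 0 :> K by have /pcharf0P -> := charK.
have h0 : f i0 *+ N + iota p = 0.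
  have tau_f : iota (u i0) * tau (f i0) = f i0 - iota (alpha i0).
    by rewrite [in RHS]fE addrK.
  have u_sigma_p : u i0 * sigma p = p + alpha i0 *+ N.
    by apply/eqP; rewrite -subr_eq pE.
  apply: (fixL i0); rewrite rmorphD rmorphMn iotaE mulrDr mulrnAr tau_f -rmorphM.
  by rewrite u_sigma_p rmorphD rmorphMn mulrnBl [iota p + _]addrC addrA subrK.
apply: (f_notin i0 (- (p / N%:R))); rewrite rmorphN fmorph_div rmorph_nat.
have NL : N%:R != 0 :> L by rewrite -(rmorph_nat iota) fmorph_eq0.
by apply: (mulIf NL); rewrite mulNr divfK // mulr_natr; apply/eqP; rewrite -addr_eq0 h0.
Qed.

End DifferenceFields.

(** * The substitution of a monomial in rational functions and Laurent series *)

Lemma fraction_ratio (R : idomainType) (x : {fraction R}) :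
  exists a b, b != 0 /\ x = FracField.tofrac a / FracField.tofrac b.
Proof.
exists (\n_(repr x)), (\d_(repr x)); split; first exact: denom_ratioP.
have dN0 : FracField.tofrac \d_(repr x) != 0 by rewrite tofrac_eq0 denom_ratioP.
apply: (mulIf dN0); rewrite divfK // -{1}[x]reprK.
unlock FracField.tofrac; rewrite -[LHS]FracField.pi_mul.
apply/eqmodP; rewrite /= FracField.equivfE /FracField.mulf.
by rewrite !numden_Ratio ?mulf_neq0 ?oner_neq0 ?denom_ratioP // !mulr1 mulrC.
Qed.

Lemma frac_map_comm (R S : idomainType) (f : {rmorphism R -> S})
    (g : {rmorphism R -> R}) (h : {rmorphism S -> S})
    (f_inj : injective f) (g_inj : injective g) (h_inj : injective h) :
    (forall x, h (f x) = f (g x)) ->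
  forall x, frac_map h_inj (frac_map f_inj x) = frac_map f_inj (frac_map g_inj x).
Proof.
move=> fgh x; have [a [b [nz_b ->]]] := fraction_ratio x.
have nz_fb : f b != 0 by rewrite -(rmorph0 f) (inj_eq f_inj).
have nz_gb : g b != 0 by rewrite -(rmorph0 g) (inj_eq g_inj).
by rewrite !frac_mapE // !fgh.
Qed.

Section Substitution.
Variables (K : fieldType) (s : K) (d : nat).
Hypothesis s_neq0 : s != 0.

(** The substitution of [s x^(d+1)] for [x].  The proof that [s] is nonzero is an
    argument so that the morphism instances, and with them the extensions to the
    fraction fields, are found from the term. *)
Definition poly_subst of s != 0 := fun p : {poly K} => p \Po (s *: 'X^(d.+1)).
Definition fps_subst of s != 0 := fun f : fps K =>
  FPS (fun m => if (d.+1 %| m)%N then s ^+ (m %/ d.+1)%N * coefs f (m %/ d.+1)%N else 0).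

Local Notation psub := (poly_subst s_neq0).
Local Notation fsub := (fps_subst s_neq0).

Lemma fps_of_poly_subst p : fsub (fps_of_poly p) = fps_of_poly (psub p).
Proof.
apply: fpsP => m /=; rewrite coef_comp_poly.
under eq_bigr do rewrite exprZn coefZ -exprM coefXn.
case: ifPn => [/dvdnP[k ->]|ndiv]; last first.
  rewrite big1 // => i _; rewrite (_ : (_ == _) = false) ?mulr0 //.
  by apply: contraNF ndiv => /eqP ->; rewrite dvdn_mulr.
rewrite mulnK //; under eq_bigr do rewrite mulnC eqn_pmul2l // eq_sym.
have [lt_k|le_k] := ltnP k (size p).
  rewrite (bigD1 (Ordinal lt_k)) //= eqxx mulr1 big1 ?addr0 1?mulrC // => i.
  by rewrite -val_eqE /= => /negbTE ->; rewrite !mulr0.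
rewrite nth_default // mulr0 big1 // => i _.
by rewrite (ltn_eqF (leq_trans (ltn_ord i) le_k)) !mulr0.
Qed.

(** Reduces multiplicativity on series to that of the composition of
    polynomials. *)
Lemma coef_fps_subst_trunc f n m : (m <= n)%N ->
  coefs (fsub f) m = (psub (fps_trunc n f))`_m.
Proof.
move=> le_mn; rewrite -[RHS]/(coefs (fps_of_poly _) m) -fps_of_poly_subst /=.
by case: ifP => // _; rewrite coef_fps_trunc // (leq_trans (leq_div _ _)).
Qed.

Fact fps_subst_zmod_morphism : zmod_morphism fsub.
Proof.
move=> f g; apply: fpsP => m /=.
by case: ifP; rewrite ?subr0 // mulrBr.
Qed.

Fact fps_subst_monoid_morphism : monoid_morphism fsub.
Proof.
split.
  rewrite -(rmorph1 (@fps_of_poly K)) fps_of_poly_subst.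
  by congr fps_of_poly; apply: (rmorph1 (comp_poly _)).
move=> f g; apply: fpsP => m; rewrite (coef_fps_mul_trunc _ _ (leqnn m)).
transitivity ((psub (fps_trunc m f * fps_trunc m g))`_m).
  rewrite -[RHS]/(coefs (fps_of_poly _) m) -fps_of_poly_subst.
  rewrite /=; case: ifP => // _; congr (_ * _).
  by apply: coef_fps_mul_trunc; apply: leq_div.
rewrite /poly_subst rmorphM /= !coefM; apply: eq_bigr => i _.
have le_im : (i <= m)%N by rewrite -ltnS.
by rewrite !coef_fps_trunc ?leq_subr // !(@coef_fps_subst_trunc _ m) ?leq_subr.
Qed.

HB.instance Definition _ := GRing.isZmodMorphism.Build (fps K) (fps K) fsub
  fps_subst_zmod_morphism.
HB.instance Definition _ := GRing.isMonoidMorphism.Build (fps K) (fps K) fsub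
  fps_subst_monoid_morphism.
HB.instance Definition _ := GRing.RMorphism.copy psub (comp_poly (s *: 'X^(d.+1))).

Lemma fps_subst_inj : injective fsub.
Proof.
move=> f g fg; apply: fpsP => m; move/(congr1 (fun h => coefs h (d.+1 * m)%N)): fg.
by rewrite /= dvdn_mulr // mulKn // => /mulfI; apply; rewrite expf_neq0.
Qed.

Lemma poly_subst_inj : injective psub.
Proof.
move=> p q pq; apply/(@fps_of_poly_inj K)/fps_subst_inj.
by rewrite !fps_of_poly_subst pq.
Qed.

Definition ratfun_subst : {rmorphism ratfun K -> ratfun K} := frac_map poly_subst_inj.
Definition laurent_subst : {rmorphism laurent K -> laurent K} := frac_map fps_subst_inj.

Lemma laurent_of_ratfun_subst x :
  laurent_subst (laurent_of_ratfun K x) = laurent_of_ratfun K (ratfun_subst x).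
Proof. exact/frac_map_comm/fps_of_poly_subst. Qed.

End Substitution.

(** * Twisted constants and periodic series *)

Definition has_order (K : nzRingType) (f : fps K) m :=
  coefs f m != 0 /\ forall i, (i < m)%N -> coefs f i = 0.

Lemma has_order_uniq (K : nzRingType) (f : fps K) m n :
  has_order f m -> has_order f n -> m = n.
Proof.
move=> [nz_m f_m] [nz_n f_n]; case: (ltngtP m n) => // [/f_n | /f_m] f0.
  by rewrite f0 eqxx in nz_m.
by rewrite f0 eqxx in nz_n.
Qed.

Lemma has_orderM (K : idomainType) (f g : fps K) m n :
  has_order f m -> has_order g n -> has_order (f * g) (m + n).
Proof.
move=> [nz_m f_m] [nz_n g_n]; split=> [|i lt_i] /=; last first.
  rewrite big1 // => j _; have [/f_m ->|le_j] := ltnP j m; first by rewrite mul0r.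
  by rewrite g_n ?mulr0 //; have := ltn_ord j; lia.
have lt_m : (m < (m + n).+1)%N by rewrite ltnS leq_addr.
rewrite (bigD1 (Ordinal lt_m)) //= addKn big1 ?addr0 ?mulf_neq0 // => j.
rewrite -val_eqE /= => neq_j; have [/f_m ->|le_j] := ltnP j m; first by rewrite mul0r.
have lt_mj : (m < j)%N by rewrite ltn_neqAle eq_sym neq_j.
by rewrite g_n ?mulr0 //; have := ltn_ord j; lia.
Qed.

Lemma has_orderXn (K : comNzRingType) (k : nat) :
  has_order (fps_of_poly 'X^k : fps K) k.
Proof.
split=> [|i lt_i] /=; rewrite coefXn; first by rewrite eqxx oner_neq0.
by rewrite (ltn_eqF lt_i).
Qed.

Section TwistedConstants.
Variables (K : fieldType) (s : K) (d : nat).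
Hypothesis s_neq0 : s != 0.

Lemma has_order_subst (f : fps K) m :
  has_order f m -> has_order (fps_subst d s_neq0 f) (d.+1 * m).
Proof.
move=> [nz_m f_m]; split=> [|i lt_i] /=.
  by rewrite dvdn_mulr // mulKn // mulf_neq0 ?expf_neq0.
by case: ifP => // _; rewrite f_m ?mulr0 // ltn_divLR // mulnC.
Qed.

(** A nonzero solution of order [v] would satisfy [a + v = b + (d + 1) v]. *)
Lemma laurent_twisted_const (a b : nat) (h : laurent K) :
    a != b %[mod d] ->
    laurent_of_fps (fps_of_poly 'X^a) * h =
      laurent_of_fps (fps_of_poly 'X^b) * laurent_subst d s_neq0 h ->
  h = 0.
Proof.
move=> neq_ab; have [f [g [nz_g ->]]] := fraction_ratio h.
have [-> _|nz_f] := eqVneq f 0; first by rewrite tofrac0 mul0r.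
have nz_sg : fps_subst d s_neq0 g != 0.
  by rewrite -(rmorph0 (fps_subst d s_neq0)) (inj_eq (@fps_subst_inj _ _ _ s_neq0)).
rewrite /laurent_subst /= frac_mapE // !mulrA -!tofracM => /eqP.
rewrite eqr_div ?tofrac_eq0 // -!tofracM tofrac_eq => /eqP eq_fg.
have [[m [nz_m f_m]] [n [nz_n g_n]]] := (fps_neq0P nz_f, fps_neq0P nz_g).
have [of_ og] : has_order f m /\ has_order g n by [].
have oL := has_orderM (has_orderM (has_orderXn K a) of_) (has_order_subst og).
have oR := has_orderM (has_orderM (has_orderXn K b) (has_order_subst of_)) og.
rewrite eq_fg in oL; have eq_mn := has_order_uniq oL oR.
case/negP: neq_ab; apply/eqP.
have eq1 : (a + d * n = b + d * m)%N by lia.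
by rewrite -(modnMDl n a d) -(modnMDl m b d) ![(_ * d)%N]mulnC ![(d * _ + _)%N]addnC eq1.
Qed.
End TwistedConstants.

(** Multiplication by [1 - x^T] leaves a polynomial. *)
Lemma eventually_periodic_rational (K : fieldType) (b : fps K) (N T : nat) :
    (0 < T)%N -> (forall n, (N <= n)%N -> coefs b (n + T) = coefs b n) ->
  exists x, laurent_of_fps b = laurent_of_ratfun K x.
Proof.
move=> T_gt0 b_per; pose q : {poly K} := 1 - 'X^T.
have nz_q : q != 0.
  apply/eqP => /(congr1 (fun p : {poly K} => p`_0)).
  rewrite coefB coef1 coefXn coef0 eqxx (ltn_eqF T_gt0) subr0.
  by move/eqP; rewrite oner_eq0.
have coef_qb n : coefs (fps_of_poly q * b) n =
    coefs b n - (if (n < T)%N then 0 else coefs b (n - T)).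
  rewrite rmorphB rmorph1 mulrBl mul1r /=; congr (_ - _).
  under eq_bigr do rewrite coefXn; case: ltnP => [lt_n|le_n].
    rewrite big1 // => i _; rewrite (ltn_eqF (leq_trans (ltn_ord i) lt_n)) mul0r //.
  have lt_T : (T < n.+1)%N by [].
  rewrite (bigD1 (Ordinal lt_T)) //= eqxx mul1r big1 ?addr0 // => i.
  by rewrite -val_eqE /= => /negbTE ->; rewrite mul0r.
pose p : {poly K} := \poly_(n < N + T) coefs (fps_of_poly q * b) n.
have qb : fps_of_poly q * b = fps_of_poly p.
  apply: fpsP => n; rewrite [RHS]/= coef_poly; case: ltnP => // le_n.
  rewrite coef_qb ltnNge (leq_trans (leq_addl _ _) le_n) /=.
  by rewrite -(b_per (n - T)%N) ?subnK ?subrr //; lia.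
exists (FracField.tofrac p / FracField.tofrac q); rewrite /laurent_of_ratfun /=.
rewrite frac_mapE // /laurent_of_fps /= -qb tofracM mulrC mulKf //.
by rewrite tofrac_eq0 -(rmorph0 (@fps_of_poly K)) (inj_eq (@fps_of_poly_inj K)).
Qed.

(** * Mahler equations and conclusion *)

Lemma frac_map_tofrac (R S : idomainType) (f : {rmorphism R -> S})
    (f_inj : injective f) a :
  frac_map f_inj (FracField.tofrac a) = FracField.tofrac (f a).
Proof.
rewrite -[FracField.tofrac a]divr1 -tofrac1 frac_mapE ?oner_neq0 //.
by rewrite rmorph1 tofrac1 divr1.
Qed.

Lemma laurent_of_ratfun_poly (K : fieldType) (p : {poly K}) :
  laurent_of_ratfun K (FracField.tofrac p) = laurent_of_fps (fps_of_poly p).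
Proof. exact: frac_map_tofrac. Qed.

Section MahlerToeplitz.
Variable K : fieldType.

Fact N1_neq0 : (-1 : K) != 0.
Proof. by rewrite oppr_eq0 oner_eq0. Qed.

Local Notation subst := (laurent_subst 3 N1_neq0).

(** The series [f - x^c f(-x^4)] keeps only the periodic part of [f]: from
    [x^c] on, the self-similar entries cancel. *)
Lemma toeplitz_mahler c (f : fps K) : toeplitz c (coefs f) ->
  exists alpha, laurent_of_fps f =
    laurent_of_ratfun K (FracField.tofrac 'X^c) * subst (laurent_of_fps f) +
    laurent_of_ratfun K alpha.
Proof.
move=> fT; pose sf := fps_subst 3 N1_neq0 f; pose b := f - fps_of_poly 'X^c * sf.
have coef_b n : (c <= n)%N ->
    coefs b n = if n == c %[mod 4] then 0 else coefs f n.
  move=> le_cn; have -> : coefs b n = coefs f n - coefs sf (n - c).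
    rewrite /= -[\sum_(_ < _) _]/(coefs (fps_of_poly _ * sf) n).
    rewrite -[coefs f]/(coefs (FPS (coefs f))); congr (_ - _).
    have lt_c : (c < n.+1)%N by [].
    rewrite [LHS]/= (bigD1 (Ordinal lt_c)) //= coefXn eqxx mul1r big1 ?addr0 // => i.
    by rewrite -val_eqE /= coefXn => /negbTE ->; rewrite mul0r.
  rewrite /sf /= -eqn_mod_dvd //; case: eqP => [eq_n|]; last by rewrite subr0.
  have [m def_n] : exists m, n = (4 * m + c)%N by exists ((n - c) %/ 4)%N; lia.
  by rewrite def_n addnK mulKn // (toeplitz_self fT) subrr.
have b_per n : (c <= n)%N -> coefs b (n + 8) = coefs b n.
  move=> le_cn; rewrite !coef_b ?(leq_trans le_cn (leq_addr _ _)) //.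
  rewrite (_ : n + 8 = 2 * 4 + n)%N ?modnMDl; last by rewrite addnC.
  by case: eqP => // neq_n; rewrite addnC (toeplitz_per fT) //; apply/eqP.
have [alpha alphaE] := eventually_periodic_rational (isT : 0 < 8)%N b_per.
exists alpha; rewrite -alphaE laurent_of_ratfun_poly /laurent_of_fps.
by rewrite [subst _]frac_map_tofrac -tofracM -tofracD addrC subrK.
Qed.

Lemma toeplitz_not_rational c (f : fps K) x : (2%:R : K) != 0 ->
  toeplitz c (coefs f) -> laurent_of_fps f <> laurent_of_ratfun K x.
Proof.
move=> nz2 fT; have [p [q [nz_q ->]]] := fraction_ratio x.
rewrite fmorph_div !laurent_of_ratfun_poly => f_pq.
have nz_fq : laurent_of_fps (fps_of_poly q) != 0.
  by rewrite tofrac_eq0 -(rmorph0 (@fps_of_poly K)) (inj_eq (@fps_of_poly_inj K)).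
suff q0 : q = 0 by rewrite q0 eqxx in nz_q.
apply: (toeplitz_irrational fT (p := p)) => //; rewrite (_ : FPS (coefs f) = f).
  apply/eqP; rewrite -tofrac_eq tofracM mulrC; apply/eqP.
  by rewrite -[FracField.tofrac f]/(laurent_of_fps f) f_pq divfK.
exact: fpsP.
Qed.

(** The multipliers [x^(c i)] of the Mahler equations and the constant 1 have
    pairwise incongruent exponents modulo 3, so there are no twisted constants
    between them. *)
Theorem toeplitz_alg_independent n (c : 'I_n -> nat) (f : 'I_n -> fps K) :
    [pchar K] =i pred0 ->
    (forall i, toeplitz (c i) (coefs (f i))) ->
    (forall i, c i != 0 %[mod 3]) ->
    (forall i j, i != j -> c i != c j %[mod 3]) ->
  alg_independent (laurent_of_ratfun K) (fun i => laurent_of_fps (f i)).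
Proof.
move=> charK fT c_neq0 c_inj.
have [alpha alphaE] := boolp.choice (fun i => toeplitz_mahler (fT i)).
have nz2 : (2%:R : K) != 0 by have /pcharf0P -> := charK.
apply: (@difference_alg_independent _ _ _ (ratfun_subst 3 N1_neq0) subst
  (laurent_of_ratfun_subst _ _) _ _ (fun i => FracField.tofrac 'X^(c i)) alpha).
- by move=> i; rewrite tofrac_eq0 monic_neq0 ?monicXn.
- exact: alphaE.
- by move=> m; rewrite -charK (fmorph_pchar (@FracField.tofrac {poly K} \o polyC)).
- move=> i h hE; apply: (@laurent_twisted_const K (-1) 3 N1_neq0 0 (c i)).
    by rewrite eq_sym.
  by rewrite expr0 -!laurent_of_ratfun_poly tofrac1 rmorph1 mul1r.
- move=> i j e neq_ij eE; apply: (fmorph_inj (laurent_of_ratfun K)); rewrite rmorph0.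
  apply: (@laurent_twisted_const K (-1) 3 N1_neq0 (c j) (c i)).
    by rewrite c_inj // eq_sym.
  by rewrite -!laurent_of_ratfun_poly laurent_of_ratfun_subst -!rmorphM eE.
- by move=> i x; apply: toeplitz_not_rational (fT i).
Qed.

End MahlerToeplitz.

Theorem corollary2p2p20 (R : realType) :
  alg_independent (laurent_of_ratfun R[i])
    (tnth [tuple laurent_of_fps (calF R[i]); laurent_of_fps (calG R[i])]).
Proof.
pose f (i : 'I_2) := tnth [tuple calF R[i]; calG R[i]] i.
pose c (i : 'I_2) := tnth [tuple 2%N; 4%N] i.
rewrite (_ : tnth _ = fun i => laurent_of_fps (f i)).
  apply: (@toeplitz_alg_independent _ 2 c f).
  - exact: Num.Theory.pchar_num.
  - case=> [[|[|//]] lt_i]; [exact: calF_toeplitz|exact: calG_toeplitz].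
  - by case=> [[|[|//]] lt_i].
  - by case=> [[|[|//]] lt_i] [[|[|//]] lt_j].
by apply/boolp.funext; case=> [[|[|//]] lt_i].
Qed.
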